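(* Let $\omega\in[0,1]$ and let $A\in\mathbb{C}^{m\times m}$, $B\in\mathbb{C}^{m\times n}$, $C\in\mathbb{C}^{n\times m}$, $D\in\mathbb{C}^{n\times n}$ be such that $XCX-XD-AX+B=0$ is in class $\mathbb{H}^\omega$, and suppose that $Q_\omega\mathbf{1}>0$, where $Q=\begin{pmatrix}D&-C\\-B&A\end{pmatrix}$. Let $\Phi$ and $\Psi$ be the extremal solutions of $XCX-XD-AX+B=0$ and of its dual $YBY-YA-DY+C=0$, respectively. Let $\chi$ be any complex number with $|\chi|=1$ such that $\omega\,\mathrm{Re}(\chi[Q]_{ii})+(1-\omega)\,\mathrm{Im}(\chi[Q]_{ii})-q_i>0$ for all $i\in\{1,\dots,m+n\}$. Apply SDA to the transformed equation $X(\chi C)X-X(\chi D)-(\chi A)X+\chi B=0$ with $\alpha=tz_\omega^\bot$, where $z_\omega^\bot=\omega+\mathrm{j}(1-\omega)$. If $t\ge\max\{\widetilde\psi_1,\widetilde\psi_2\}$, where $$\widetilde\psi_1=\max_{i=n+1,\dots,m+n}\frac{p^\chi_{\omega,i}}{\varpi},\qquad\widetilde\psi_2=\max_{i=1,\dots,n}\frac{p^\chi_{\omega,i}}{\varpi},$$ then the sequences $\{E_k\},\{F_k\},\{G_k\},\{H_k\}$ are well-defined and $\{H_k\}$ and $\{G_k\}$ converge quadratically to $\Phi$ and $\Psi$, respectively.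
   Context: For a complex square matrix $M$ and a real $\omega\in[0,1]$, the $\omega$-comparison matrix $M_\omega$ is the real matrix with entries $[M_\omega]_{ii}=\omega\,\mathrm{Re}([M]_{ii})+(1-\omega)\,\mathrm{Im}([M]_{ii})$ and $[M_\omega]_{ij}=-|[M]_{ij}|$ for $i\ne j$. A real square matrix $M$ is a nonsingular M-matrix if all its off-diagonal entries are nonpositive and $Mu>0$ (entrywise) for some vector $u>0$. $\mathbf{1}$ is the all-ones column vector; $\mathrm{j}$ is the imaginary unit. The equation $XCX-XD-AX+B=0$ is in class $\mathbb{H}^\omega$ if $Q_\omega$ is a nonsingular M-matrix. Notation: $\varpi=\omega^2+(1-\omega)^2$, $q_i=\sum_{j\ne i}|[Q]_{ij}|$, and for $i=1,\dots,m+n$ $$\frac{p^\chi_{\omega,i}}{\varpi}=\frac{\varpi|[Q]_{ii}|^2-q_i^2}{2\varpi\left(\omega\mathrm{Re}(\chi[Q]_{ii})+(1-\omega)\mathrm{Im}(\chi[Q]_{ii})-q_i\right)}.$$ Extremal solutions: $\Phi$ is the unique solution of $XCX-XD-AX+B=0$ such that every eigenvalue $\lambda$ of $D-C\Phi$ satisfies $\omega\,\mathrm{Re}(\lambda)+(1-\omega)\,\mathrm{Im}(\lambda)>0$; $\Psi$ is the unique solution of $YBY-YA-DY+C=0$ such that every eigenvalue $\lambda$ of $A-B\Psi$ satisfies the same inequality (both exist and are unique under these hypotheses). SDA with parameter $\alpha$ applied to an equation $X\mathsf CX-X\mathsf D-\mathsf AX+\mathsf B=0$ is the following algorithm with $\beta=\alpha$: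 put $\mathsf A_\beta=\mathsf A+\beta I$, $\mathsf D_\alpha=\mathsf D+\alpha I$, $W=\mathsf A_\beta-\mathsf B\mathsf D_\alpha^{-1}\mathsf C$, $V=\mathsf D_\alpha-\mathsf C\mathsf A_\beta^{-1}\mathsf B$, and $$E_0=I-(\alpha+\beta)V^{-1},\ F_0=I-(\alpha+\beta)W^{-1},\ G_0=(\alpha+\beta)\mathsf D_\alpha^{-1}\mathsf CW^{-1},\ H_0=(\alpha+\beta)W^{-1}\mathsf B\mathsf D_\alpha^{-1};$$ for $k\ge0$, $$E_{k+1}=E_k(I-G_kH_k)^{-1}E_k,\quad F_{k+1}=F_k(I-H_kG_k)^{-1}F_k,$$ $$G_{k+1}=G_k+E_k(I-G_kH_k)^{-1}G_kF_k,\quad H_{k+1}=H_k+F_k(I-H_kG_k)^{-1}H_kE_k.$$ ''Well-defined'' means all inverses involved exist. Quadratic convergence of the doubling algorithm means $\limsup_{k\to\infty}\|H_k-\Phi\|^{1/2^k}<1$ and $\limsup_{k\to\infty}\|G_k-\Psi\|^{1/2^k}<1$. *)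

(* Defs.v *)
From HB Require Import structures.
From mathcomp Require Import all_boot all_order all_algebra.
From mathcomp Require Import all_classical all_reals all_analysis.
From mathcomp Require Export complex.

Set Implicit Arguments.
Unset Strict Implicit.
Unset Printing Implicit Defensive.

Import Order.TTheory GRing.Theory Num.Theory.
Import ComplexField.Normc.

Local Open Scope ring_scope.
Local Open Scope complex_scope.

Section Comparison.
Variable R : realType.

(* Re (conj z * x) for z = omega + i (1 - omega). *)
Definition Rew (omega : R) (x : R[i]) : R :=
  omega * complex.Re x + (1 - omega) * complex.Im x.

Definition zperp (omega : R) : R[i] := omega +i* (1 - omega).

Definition varpi (omega : R) : R := omega ^+ 2 + (1 - omega) ^+ 2.

Definition comparison_mx (omega : R) k (M : 'M[R[i]]_k) : 'M[R]_k :=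
  \matrix_(i, j) if i == j then Rew omega (M i i) else - normc (M i j).

Definition pos_cV k (u : 'cV[R]_k) : Prop := forall i, 0 < u i 0.

Definition nonsingular_Mmatrix k (M : 'M[R]_k) : Prop :=
  (forall i j, i != j -> M i j <= 0) /\
  (exists u : 'cV[R]_k, pos_cV u /\ pos_cV (M *m u)).

Definition offdiag_sum k (Q : 'M[R[i]]_k) (i : 'I_k) : R :=
  \sum_(j < k | j != i) normc (Q i j).

(* The quotient p^chi_{omega,i} / varpi. *)
Definition p_ratio (omega : R) (chi : R[i]) k (Q : 'M[R[i]]_k) (i : 'I_k) : R :=
  (varpi omega * normc (Q i i) ^+ 2 - offdiag_sum Q i ^+ 2) /
  (2 * varpi omega * (Rew omega (chi * Q i i) - offdiag_sum Q i)).

(* Maximum of a nonempty finite family; the seed is a member of the family. *)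
Definition max_ord k (f : 'I_k.+1 -> R) : R :=
  \big[Num.max/f ord0]_(i < k.+1) f i.

End Comparison.

(* The equation X C X - X D - A X + B = 0 with X : m x n; its dual
   Y B Y - Y A - D Y + C = 0 is the same equation for (D, C, B, A). *)
Section Riccati.
Variable R : realType.
Implicit Types m n : nat.

Definition riccati_Q m n (A : 'M[R[i]]_m) (B : 'M[R[i]]_(m, n))
    (C : 'M[R[i]]_(n, m)) (D : 'M[R[i]]_n) : 'M[R[i]]_(n + m) :=
  block_mx D (- C) (- B) A.

Definition riccati_sol m n (A : 'M[R[i]]_m) (B : 'M[R[i]]_(m, n))
    (C : 'M[R[i]]_(n, m)) (D : 'M[R[i]]_n) (X : 'M[R[i]]_(m, n)) : Prop :=
  X *m C *m X - X *m D - A *m X + B = 0.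

Definition class_H (omega : R) m n (A : 'M[R[i]]_m) (B : 'M[R[i]]_(m, n))
    (C : 'M[R[i]]_(n, m)) (D : 'M[R[i]]_n) : Prop :=
  nonsingular_Mmatrix (comparison_mx omega (riccati_Q A B C D)).

(* The properties that characterise the extremal solution.  Existence and
   uniqueness, which hold for the equations of class H and their duals, are
   not part of the definition. *)
Definition extremal_sol (omega : R) m n (A : 'M[R[i]]_m) (B : 'M[R[i]]_(m, n))
    (C : 'M[R[i]]_(n, m)) (D : 'M[R[i]]_n) (X : 'M[R[i]]_(m, n)) : Prop :=
  riccati_sol A B C D X /\
  (forall lambda : R[i], eigenvalue (D - C *m X) lambda -> 0 < Rew omega lambda).

End Riccati.

Section SDA.
Variables (F : fieldType) (m n : nat).

Record sda_state := SdaState {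
  sda_E : 'M[F]_n;
  sda_F : 'M[F]_m;
  sda_G : 'M[F]_(n, m);
  sda_H : 'M[F]_(m, n) }.

Variables (alpha : F).
Variables (A : 'M[F]_m) (B : 'M[F]_(m, n)) (C : 'M[F]_(n, m)) (D : 'M[F]_n).

Definition sda_A : 'M[F]_m := A + alpha%:M.
Definition sda_D : 'M[F]_n := D + alpha%:M.
Definition sda_W : 'M[F]_m := sda_A - B *m invmx sda_D *m C.
Definition sda_V : 'M[F]_n := sda_D - C *m invmx sda_A *m B.

Definition sda_init : sda_state := SdaState
  (1%:M - (alpha + alpha) *: invmx sda_V)
  (1%:M - (alpha + alpha) *: invmx sda_W)
  ((alpha + alpha) *: (invmx sda_D *m C *m invmx sda_W))
  ((alpha + alpha) *: (invmx sda_W *m B *m invmx sda_D)).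

Definition sda_step (s : sda_state) : sda_state :=
  let: SdaState Ek Fk Gk Hk := s in
  let IGH := invmx (1%:M - Gk *m Hk) in
  let IHG := invmx (1%:M - Hk *m Gk) in
  SdaState
    (Ek *m IGH *m Ek)
    (Fk *m IHG *m Fk)
    (Gk + Ek *m IGH *m Gk *m Fk)
    (Hk + Fk *m IHG *m Hk *m Ek).

Definition sda (k : nat) : sda_state := iter k sda_step sda_init.

(* invmx is total, so the existence of the inverses is stated separately. *)
Definition sda_well_defined : Prop :=
  [/\ sda_A \in unitmx, sda_D \in unitmx, sda_W \in unitmx, sda_V \in unitmx
    & forall k, (1%:M - sda_G (sda k) *m sda_H (sda k) \in unitmx) /\
                (1%:M - sda_H (sda k) *m sda_G (sda k) \in unitmx)].

End SDA.

Section QuadraticConvergence.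
Variables (R : realType) (m n : nat).

Definition matrix_norm (N : 'M[R[i]]_(m, n) -> R) : Prop :=
  [/\ forall M, 0 <= N M,
      forall M, N M = 0 -> M = 0,
      forall (a : R[i]) M, N (a *: M) = normc a * N M
    & forall M1 M2, N (M1 + M2) <= N M1 + N M2].

(* The limsup is taken in the extended reals, where it is meaningful without
   any boundedness assumption. *)
Definition quadratic_cvg (X : nat -> 'M[R[i]]_(m, n)) (L : 'M[R[i]]_(m, n)) :
    Prop :=
  forall N, matrix_norm N ->
    (limn_esup (fun k => (N (X k - L) `^ (1 / 2 ^+ k))%:E) < 1%:E)%E.

End QuadraticConvergence.

(* Main.v *)
Require Import Defs.
From mathcomp Require Import all_boot all_order all_algebra.
From mathcomp Require Import all_classical all_reals all_analysis.
From mathcomp Require Import ring lra.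

Import Order.TTheory GRing.Theory Num.Theory.
Import ComplexField.Normc.

Local Open Scope ring_scope.
Local Open Scope complex_scope.

(** The whole argument takes place in one picture.  Put
    [U_k = block_mx E_k G_k H_k F_k] and let
    [Q' = block_mx (chi D) (chi C) (chi B) (chi A)], which differs from chi Q
    only by signs off the diagonal.  A direct computation
    ([sda_init_cayley]) shows that [U_0] is the Cayley transform
    (Q' + alpha)^-1 (Q' - alpha).  The lower bound on t is exactly what makes
    |d - alpha| + q < |d + alpha| - q for each diagonal entry d of Q' with
    off-diagonal row sum q ([shift_dominance]), and this row inequality makes
    the Cayley transform a strict contraction for the maximum norm
    ([cayley_contract]).

    Read [U_k] as a two-port, (x, y') |-> (x', y) with x' = E x + G y' and
    y = H x + F y'.  One doubling step connects two copies of this two-port in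
    series (Redheffer's star product, [sda_step_compose]), and a series
    connection of strict contractions is a strict contraction
    ([contractive_step]).  Hence every [U_k] is one.  In particular G_k H_k
    never has the eigenvalue 1, so that all the inverses exist.

    For convergence, let S = chi (D - C Phi) and let
    T = (S - alpha) (S + alpha)^-1.  The relation
    T = E + G Phi T, Phi = H + F Phi T, which says that the two-port is
    satisfied by the signals x = 1, x' = T, y = Phi, y' = Phi T, holds for
    k = 0 and passes through a doubling step with T replaced by its square.
    Therefore Phi - H_k = F_k Phi T^(2^k) with F_k bounded, and it remains to
    see that the powers of T decay geometrically.  The eigenvalues of D - C Phi
    are eigenvalues of block_mx D (- C) B (- A); by Gershgorin's theorem and
    the assumption Q_omega 1 > 0, those in the half-plane Rew > 0 lie in the
    discs of the rows of D, and these discs stay in the half-plane after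
    multiplication by chi ([riccati_spectrum_rotate]).  So the eigenvalues of S
    lie in the open half-plane, which the Cayley transform maps into the unit
    disc ([cayley_spectrum]), and the Cayley-Hamilton theorem turns this into
    decay of the powers ([power_decay]).

    The statement for G_k and Psi is the same one for the dual equation:
    exchanging (A, B) with (D, C) exchanges (E, G) with (F, H), and everything
    above is symmetric under this exchange. *)

(** * Moduli and the half-plane of the shift *)

Lemma normc_ge0 {R : realType} (x : R[i]) : 0 <= normc x.
Proof. by case: x => a b; exact: sqrtr_ge0. Qed.

Lemma normc_sqr {R : realType} (x : R[i]) :
  normc x ^+ 2 = complex.Re x ^+ 2 + complex.Im x ^+ 2.
Proof. by case: x => a b /=; rewrite sqr_sqrtr // addr_ge0 // sqr_ge0. Qed.

Lemma normcB_le {R : realType} (x y : R[i]) :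
  normc x <= normc (x + y) + normc y.
Proof.
by have := le_normcD (x + y) (- y); rewrite [normc (- y)]normcN addrK.
Qed.

Lemma normc_sum {R : realType} (I : finType) (P : pred I) (F : I -> R[i]) :
  normc (\sum_(i | P i) F i) <= \sum_(i | P i) normc (F i).
Proof.
elim/big_ind2: _ => [|x1 x2 y1 y2 h1 h2|//]; first by rewrite normc0.
exact: le_trans (le_normcD _ _) (lerD h1 h2).
Qed.

Lemma RewD {R : realType} (omega : R) (x y : R[i]) :
  Rew omega (x + y) = Rew omega x + Rew omega y.
Proof. by case: x y => a b [c d]; rewrite /Rew /=; ring. Qed.

Lemma RewN {R : realType} (omega : R) (x : R[i]) :
  Rew omega (- x) = - Rew omega x.
Proof. by case: x => a b; rewrite /Rew /=; ring. Qed.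

Lemma Rew_zperp {R : realType} (omega t : R) :
  Rew omega (t%:C * zperp omega) = t * varpi omega.
Proof. by rewrite /Rew /zperp /varpi /=; ring. Qed.

Lemma Rew_le_normc {R : realType} (omega : R) (x : R[i]) :
  0 <= omega <= 1 -> Rew omega x <= normc x.
Proof.
move=> /andP[ho0 ho1]; have := normc_ge0 x; have := normc_sqr x.
rewrite /Rew; move: (normc x) (complex.Re x) (complex.Im x) => N a b hN N0.
have ha : a <= N by nra.
have hb : b <= N by nra.
by nra.
Qed.

Lemma varpi_gt0 {R : realType} (omega : R) : 0 < varpi omega.
Proof. by rewrite /varpi; nra. Qed.

Lemma normc_subD_sqr {R : realType} (omega t : R) (d : R[i]) :
  let a := t%:C * zperp omega in
  normc (d - a) ^+ 2 =
    normc d ^+ 2 - 2 * t * Rew omega d + t ^+ 2 * varpi omega /\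
  normc (d + a) ^+ 2 =
    normc d ^+ 2 + 2 * t * Rew omega d + t ^+ 2 * varpi omega.
Proof.
rewrite /= !normc_sqr; case: d => x y.
by rewrite /Rew /zperp /varpi /=; split; ring.
Qed.

(** With sigma = sqrt varpi = |zperp| and s = Rew d, the condition on t says
    that |d - a|^2 <= (t sigma - q / sigma)^2, while the Cauchy-Schwarz
    inequality s <= sigma |d| gives |d + a| >= t sigma + s / sigma.  As
    sigma <= 1 and q < s, both sides of the conclusion are separated by
    t sigma = |a|. *)
Lemma shift_dominance {R : realType} (omega q t : R) (d : R[i]) :
  0 <= omega <= 1 -> 0 <= q -> 0 < Rew omega d - q ->
  (varpi omega * normc d ^+ 2 - q ^+ 2) /
    (2 * varpi omega * (Rew omega d - q)) <= t ->
  let a := t%:C * zperp omega in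
  0 < t /\ normc (d - a) + q < normc (d + a) - q.
Proof.
move=> /andP[ho0 ho1] q0 sq.
have w0 := varpi_gt0 omega.
have w1 : varpi omega <= 1 by rewrite /varpi; nra.
have cs : Rew omega d ^+ 2 <= varpi omega * normc d ^+ 2.
  rewrite normc_sqr /Rew /varpi -subr_ge0.
  set x := complex.Re d; set y := complex.Im d.
  rewrite (_ : _ - _ = (omega * y - (1 - omega) * x) ^+ 2) ?sqr_ge0 //; ring.
rewrite ler_pdivrMr; last by rewrite !mulr_gt0.
move=> ht a.
have [hm hp] := normc_subD_sqr omega t d.
rewrite -/a in hm hp.
have nm := normc_ge0 (d - a); have np := normc_ge0 (d + a).
move: sq ht hm hp cs nm np w0 w1.
set s := Rew omega d; set w := varpi omega.
set N := normc d; set M := normc (d - a); set P := normc (d + a).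
move=> sq ht hm hp cs nm np w0 w1.
(* t sigma - q / sigma must be nonnegative before a square root is taken; by
   Cauchy-Schwarz the quotient bounding t is at least (s + q) / (2 w). *)
have tq : q < t * w.
  have : (s - q) * (s + q) <= (s - q) * (2 * w * t) by nra.
  rewrite ler_pM2l // => ?; nra.
have t0 : 0 < t by rewrite -(pmulr_lgt0 _ w0); exact: le_lt_trans q0 tq.
split=> //.
set r := Num.sqrt w.
have r0 : 0 < r by rewrite sqrtr_gt0.
have rr : r ^+ 2 = w by rewrite sqr_sqrtr // ltW.
have r1 : r <= 1 by nra.
have hM : r * M <= t * w - q.
  rewrite -ler_sqr ?nnegrE ?mulr_ge0 ?(ltW r0) // ?subr_ge0 ?(ltW tq) //.
  rewrite exprMn rr hm; nra.
have hP : t * w + s <= r * P.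
  rewrite -ler_sqr ?nnegrE ?mulr_ge0 ?(ltW r0) //; last by nra.
  rewrite exprMn rr hp; nra.
have : r * (M + q) < r * (P - q) by nra.
by rewrite ltr_pM2l.
Qed.

(** * Maximum modulus of a matrix and row estimates *)

Lemma unitmx_ker0 {F : fieldType} {k : nat} (M : 'M[F]_k) :
  (forall x : 'cV[F]_k, M *m x = 0 -> x = 0) -> M \in unitmx.
Proof.
move=> inj; rewrite unitmxE unitfE -det_tr; apply/negP => /det0P [v v0 hv].
case/negP: v0; rewrite -trmx_eq0; apply/eqP/inj.
by rewrite -[M]trmxK -trmx_mul hv trmx0.
Qed.

Definition mxsup {R : realType} {m n : nat} (M : 'M[R[i]]_(m, n)) : R :=
  \big[Num.max/0]_(p : 'I_m * 'I_n) normc (M p.1 p.2).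

Lemma le_mxsup {R : realType} {m n : nat} (M : 'M[R[i]]_(m, n)) i j :
  normc (M i j) <= mxsup M.
Proof. by have := le_bigmax 0 (fun p => normc (M p.1 p.2)) (i, j). Qed.

Lemma mxsup_le {R : realType} {m n : nat} (M : 'M[R[i]]_(m, n)) b :
  0 <= b -> (forall i j, normc (M i j) <= b) -> mxsup M <= b.
Proof. by move=> b0 h; apply/bigmax_leP; split. Qed.

Lemma mxsup_ge0 {R : realType} {m n : nat} (M : 'M[R[i]]_(m, n)) :
  0 <= mxsup M.
Proof.
by rewrite /mxsup; elim/big_rec: _ => // p x _; rewrite le_max orbC => ->.
Qed.

Lemma mxsup_attained {R : realType} {m n : nat} (M : 'M[R[i]]_(m, n)) :
  0 < mxsup M -> exists i j, mxsup M = normc (M i j).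
Proof.
rewrite /mxsup; elim/big_rec: _ => [|[i j] x _ IH /=]; first by rewrite ltxx.
by rewrite maxEle; case: ifP => _ h; [exact: IH | exists i, j].
Qed.

Lemma mxsup_gt0 {R : realType} {m n : nat} (M : 'M[R[i]]_(m, n)) :
  M <> 0 -> 0 < mxsup M.
Proof.
move=> M0; rewrite lt_neqAle mxsup_ge0 andbT; apply/eqP => h.
apply: M0; apply/matrixP => i j; rewrite mxE; apply: eq0_normc.
by apply/eqP; rewrite eq_le normc_ge0 andbT h le_mxsup.
Qed.

Lemma mxsup0 {R : realType} {m n : nat} : mxsup (0 : 'M[R[i]]_(m, n)) = 0.
Proof.
apply/eqP; rewrite eq_le mxsup_ge0 andbT.
by apply: mxsup_le => // i j; rewrite mxE normc0.
Qed.

Lemma mxsupD {R : realType} {m n : nat} (M N : 'M[R[i]]_(m, n)) :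
  mxsup (M + N) <= mxsup M + mxsup N.
Proof.
apply: mxsup_le => [|i j]; first by rewrite addr_ge0 ?mxsup_ge0.
by rewrite mxE (le_trans (le_normcD _ _)) ?lerD ?le_mxsup.
Qed.

Lemma mxsupZ {R : realType} {m n : nat} (a : R[i]) (M : 'M[R[i]]_(m, n)) :
  mxsup (a *: M) <= normc a * mxsup M.
Proof.
apply: mxsup_le => [|i j]; first by rewrite mulr_ge0 ?mxsup_ge0 ?normc_ge0.
by rewrite mxE normcM ler_wpM2l ?normc_ge0 ?le_mxsup.
Qed.

Lemma mxsupM {R : realType} {m n p : nat} (M : 'M[R[i]]_(m, n))
    (N : 'M[R[i]]_(n, p)) :
  mxsup (M *m N) <= n%:R * mxsup M * mxsup N.
Proof.
apply: mxsup_le => [|i j]; first by rewrite !mulr_ge0 ?mxsup_ge0.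
rewrite mxE; apply: (le_trans (normc_sum _ _ _)).
apply: (@le_trans _ _ (\sum_(k < n) mxsup M * mxsup N)).
  by apply: ler_sum => k _; rewrite normcM ler_pM ?normc_ge0 ?le_mxsup.
by rewrite sumr_const card_ord -mulrA mulr_natl.
Qed.

(** The off-diagonal absolute row sum of [block_mx D C B A] along a row of
    [D]; keeping the blocks apart makes the exchange of (A, B) and (D, C) a
    mere permutation of arguments. *)
Definition rowsum {R : realType} {m n : nat} (D : 'M[R[i]]_n)
    (C : 'M[R[i]]_(n, m)) (i : 'I_n) : R :=
  offdiag_sum D i + \sum_j normc (C i j).

Lemma rowsum_ge0 {R : realType} {m n : nat} (D : 'M[R[i]]_n)
    (C : 'M[R[i]]_(n, m)) i : 0 <= rowsum D C i.
Proof. by rewrite addr_ge0 // sumr_ge0 // => j _; exact: normc_ge0. Qed.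

Lemma rowsum_shift {R : realType} {m n : nat} (a : R[i]) (D : 'M[R[i]]_n)
    (C : 'M[R[i]]_(n, m)) i : rowsum (D + a%:M) C i = rowsum D C i.
Proof.
congr (_ + _); apply: eq_bigr => j ji.
by rewrite !mxE eq_sym (negbTE ji) addr0.
Qed.

(** The common core of Gershgorin's theorem and of the contraction estimate:
    apart from its diagonal term, a row acts with norm at most its row sum. *)
Lemma row_estimate {R : realType} {m n p : nat} (D : 'M[R[i]]_n)
    (C : 'M[R[i]]_(n, m)) (x : 'M[R[i]]_(n, p)) (y : 'M[R[i]]_(m, p)) c i j :
  mxsup x <= c -> mxsup y <= c ->
  normc ((D *m x + C *m y) i j - D i i * x i j) <= rowsum D C i * c.
Proof.
move=> hx hy; rewrite !mxE (bigD1 i) //=.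
have -> (z w v : R[i]) : z + w + v - z = w + v by ring.
rewrite (le_trans (le_normcD _ _)) // mulrDl !mulr_suml.
by apply: lerD; apply: (le_trans (normc_sum _ _ _)); apply: ler_sum => k _;
  rewrite normcM ler_wpM2l ?normc_ge0 // (le_trans (le_mxsup _ _ _)).
Qed.

(** Look at a row i where x' attains its maximum c, which is also a bound for
    y: the equation gives
    (|D_ii + a| - q) c <= (|D_ii - a| + q) b, whence c < b. *)
Lemma cayley_row_contract {R : realType} {m n p : nat} (a : R[i])
    (D : 'M[R[i]]_n) (C : 'M[R[i]]_(n, m))
    (x x' : 'M[R[i]]_(n, p)) (y y' : 'M[R[i]]_(m, p)) b :
  (forall i, normc (D i i - a) + rowsum D C i <
             normc (D i i + a) - rowsum D C i) ->
  (D + a%:M) *m x' + C *m y = (D - a%:M) *m x + C *m y' ->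
  0 < b -> mxsup x <= b -> mxsup y' <= b -> mxsup y <= mxsup x' ->
  mxsup x' < b.
Proof.
move=> dom eqn b0 hx hy' hy; rewrite ltNge; apply/negP => hb.
have [i [j hc]] := mxsup_attained x' (lt_le_trans b0 hb).
have h1 := row_estimate (D + a%:M) C x' y (mxsup x') i j (lexx _) hy.
have h2 := row_estimate (D + (- a)%:M) C x y' b i j hx hy'.
have dg (e : R[i]) : (D + e%:M) i i = D i i + e by rewrite !mxE eqxx mulr1n.
rewrite rowsum_shift dg eqn in h1; rewrite rowsum_shift dg raddfN in h2.
set z := ((D - a%:M) *m x + C *m y') i j in h1; rewrite -/z in h2.
have {h1} hp : normc (D i i + a) * normc (x' i j) <=
    normc z + rowsum D C i * mxsup x'.
  rewrite -normcM -[normc (_ * _)]normcN.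
  apply: (le_trans (normcB_le _ z)); rewrite addrC lerD2l.
  by rewrite addrC.
have {h2} hm : normc z <= normc (D i i - a) * b + rowsum D C i * b.
  rewrite -[z](subrK ((D i i - a) * x i j)) addrC.
  rewrite (le_trans (le_normcD _ _)) // lerD // normcM ler_wpM2l ?normc_ge0 //.
  exact: le_trans (le_mxsup _ _ _) hx.
rewrite -hc in hp; have {}dom := dom i.
have := normc_ge0 (D i i - a); have := rowsum_ge0 D C i.
move: (rowsum D C i) (normc (D i i - a)) (normc (D i i + a)) dom hm hp.
move: (normc z) (mxsup x') hb => Z c hb q M P dom hm hp q0 M0.
have : c * (P - q) <= (M + q) * b by clear eqn; nra.
clear eqn; nra.
Qed.

(** * The starting point: a contractive Cayley transform *)

Definition cayley_dominant {R : realType} {m n : nat} (a : R[i])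
    (D : 'M[R[i]]_n) (C : 'M[R[i]]_(n, m)) : Prop :=
  forall i, normc (D i i - a) + rowsum D C i <
            normc (D i i + a) - rowsum D C i.

(** Strict contractivity of [block_mx E G H F] for the maximum norm,
    applied to each column of x and y.  A bound b takes the place of the norm
    of the pair, and strictness takes the place of a contraction factor: in
    this form the property passes through the doubling step unchanged. *)
Definition contractive {R : realType} {m n : nat} (E : 'M[R[i]]_n)
    (F : 'M[R[i]]_m) (G : 'M[R[i]]_(n, m)) (H : 'M[R[i]]_(m, n)) : Prop :=
  forall p (x : 'M[R[i]]_(n, p)) (y : 'M[R[i]]_(m, p)) b,
    0 < b -> mxsup x <= b -> mxsup y <= b ->
    mxsup (E *m x + G *m y) < b /\ mxsup (H *m x + F *m y) < b.

(** The four blocks of (Q' + a) U = Q' - a for Q' = [block_mx D C B A] and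
    U = [block_mx E0 G0 H0 F0]. *)
Definition cayley_eqs {F : fieldType} {m n : nat} (a : F) (A : 'M[F]_m)
    (B : 'M[F]_(m, n)) (C : 'M[F]_(n, m)) (D : 'M[F]_n)
    (E0 : 'M[F]_n) (F0 : 'M[F]_m) (G0 : 'M[F]_(n, m)) (H0 : 'M[F]_(m, n)) :=
  [/\ (D + a%:M) *m E0 + C *m H0 = D - a%:M,
      (D + a%:M) *m G0 + C *m F0 = C,
      B *m E0 + (A + a%:M) *m H0 = B &
      B *m G0 + (A + a%:M) *m F0 = A - a%:M].

Lemma cayley_contract {R : realType} {m n p : nat} (a : R[i])
    (A : 'M[R[i]]_m) (B : 'M[R[i]]_(m, n)) (C : 'M[R[i]]_(n, m))
    (D : 'M[R[i]]_n) (x x' : 'M[R[i]]_(n, p)) (y y' : 'M[R[i]]_(m, p)) b :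
  cayley_dominant a D C -> cayley_dominant a A B ->
  (D + a%:M) *m x' + C *m y = (D - a%:M) *m x + C *m y' ->
  B *m x' + (A + a%:M) *m y = B *m x + (A - a%:M) *m y' ->
  0 < b -> mxsup x <= b -> mxsup y' <= b ->
  mxsup x' < b /\ mxsup y < b.
Proof.
move=> domD domA e1 e2 b0 hx hy'.
have [le_yx | /ltW le_xy] := leP (mxsup y) (mxsup x').
  have h := cayley_row_contract _ _ _ _ _ _ _ _ domD e1 b0 hx hy' le_yx.
  by split=> //; exact: le_lt_trans le_yx h.
rewrite addrC [RHS]addrC in e2.
have h := cayley_row_contract _ _ _ _ _ _ _ _ domA e2 b0 hy' hx le_xy.
by split=> //; exact: le_lt_trans le_xy h.
Qed.

Lemma cayley_ker0 {R : realType} {m n p : nat} (a : R[i])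
    (A : 'M[R[i]]_m) (B : 'M[R[i]]_(m, n)) (C : 'M[R[i]]_(n, m))
    (D : 'M[R[i]]_n) (x : 'M[R[i]]_(n, p)) (y : 'M[R[i]]_(m, p)) :
  cayley_dominant a D C -> cayley_dominant a A B ->
  (D + a%:M) *m x + C *m y = 0 -> B *m x + (A + a%:M) *m y = 0 ->
  x = 0 /\ y = 0.
Proof.
move=> domD domA e1 e2.
have h b : 0 < b -> mxsup x < b /\ mxsup y < b.
  move=> b0.
  apply: (cayley_contract a A B C D 0 x y 0 b domD domA) => //;
    by rewrite ?mulmx0 ?addr0 ?mxsup0 // ltW.
split; apply: contrapT => /mxsup_gt0 /h [].
  by rewrite ltxx.
by move=> _; rewrite ltxx.
Qed.

Lemma shift_unit {R : realType} {m n : nat} (a : R[i]) (C : 'M[R[i]]_(n, m))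
    (D : 'M[R[i]]_n) :
  cayley_dominant a D C -> D + a%:M \in unitmx.
Proof.
move=> dom; apply: unitmx_ker0 => x hx; apply: contrapT => /mxsup_gt0 x0.
suff : mxsup x < mxsup x by rewrite ltxx.
apply: (cayley_row_contract a D C 0 x 0 0 _ dom) => //;
  by rewrite ?hx ?mulmx0 ?mxsup0 // ltW.
Qed.

(** [sda_W] is the Schur complement of D + a in the dominant matrix Q' + a, so
    a kernel vector y extends to one of Q' + a.  Exchanging (A, B) with (D, C)
    gives the invertibility of [sda_V]. *)
Lemma schur_unit {R : realType} {m n : nat} (a : R[i])
    (A : 'M[R[i]]_m) (B : 'M[R[i]]_(m, n)) (C : 'M[R[i]]_(n, m))
    (D : 'M[R[i]]_n) :
  cayley_dominant a D C -> cayley_dominant a A B ->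
  sda_W a A B C D \in unitmx.
Proof.
move=> domD domA; apply: unitmx_ker0 => y hy.
have uD := shift_unit _ _ _ domD.
pose x := - (invmx (sda_D a D) *m C *m y).
have [] // := cayley_ker0 a A B C D x y domD domA.
  by rewrite -/(sda_D a D) /x mulmxN !mulmxA mulmxV // mul1mx addNr.
rewrite /x mulmxN !mulmxA addrC -mulmxBl.
exact: hy.
Qed.

(** The initial matrices are 1 - 2 a (Q' + a)^-1 written with Schur
    complements; the only identity needed beyond the definitions is the
    Woodbury formula for V^-1. *)
Lemma sda_init_cayley {F : fieldType} {m n : nat} (a : F) (A : 'M[F]_m)
    (B : 'M[F]_(m, n)) (C : 'M[F]_(n, m)) (D : 'M[F]_n) :
  sda_A a A \in unitmx -> sda_D a D \in unitmx ->
  sda_W a A B C D \in unitmx -> sda_V a A B C D \in unitmx ->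
  let s := sda_init a A B C D in
  cayley_eqs a A B C D (sda_E s) (sda_F s) (sda_G s) (sda_H s).
Proof.
rewrite /sda_init /= /cayley_eqs -/(sda_A a A) -/(sda_D a D).
have eD : D - a%:M = sda_D a D - (a + a)%:M.
  by rewrite /sda_D raddfD /= opprD addrA addrK.
have eA : A - a%:M = sda_A a A - (a + a)%:M.
  by rewrite /sda_A raddfD /= opprD addrA addrK.
rewrite eD eA /sda_W /sda_V => {eD eA}.
move: (sda_A a A) (sda_D a D) => a' d ua ud.
set W := a' - B *m invmx d *m C; set V := d - C *m invmx a' *m B.
move=> uW uV.
have WE : B *m invmx d *m C = a' - W by rewrite /W subKr.
set X := invmx W *m B *m invmx d.
have WX : W *m X = B *m invmx d by rewrite /X !mulmxA mulmxV // mul1mx.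
clearbody X.
(* The Woodbury formula, verified by multiplying with V. *)
have VE : invmx V = invmx d + invmx d *m C *m X.
  suff h : V *m (invmx d + invmx d *m C *m X) = 1%:M.
    by rewrite -[LHS]mulmx1 -h mulmxA mulVmx // mul1mx.
  have e1 : V *m invmx d = 1%:M - C *m invmx a' *m (B *m invmx d).
    by rewrite /V mulmxBl mulmxV // !mulmxA.
  have e2 : C *m invmx a' *m (B *m invmx d) *m (C *m X) =
      C *m X - C *m invmx a' *m (B *m invmx d).
    transitivity (C *m invmx a' *m (B *m invmx d *m C *m X)).
      by rewrite !mulmxA.
    by rewrite WE mulmxBl WX mulmxBr !mulmxA mulmxKV.
  rewrite -[_ *m C *m X]mulmxA mulmxDr [V *m (_ *m _)]mulmxA e1 mulmxBl.
  by rewrite mul1mx e2 subKr subrK.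
have dV : d *m invmx V = 1%:M + C *m X.
  by rewrite VE mulmxDr mulmxV // !mulmxA mulmxV // mul1mx.
have BV : B *m invmx V = a' *m X.
  by rewrite VE mulmxDr !mulmxA WE mulmxBl WX addrC subrK.
have BW : B *m (invmx d *m C *m invmx W) = a' *m invmx W - 1%:M.
  by rewrite !mulmxA WE mulmxBl mulmxV.
split.
- rewrite mulmxBr mulmx1 -!scalemxAr dV scalerDr scalemx1 opprD addrA.
  by rewrite subrK.
- rewrite mulmxBr mulmx1 -!scalemxAr !mulmxA mulmxV // mul1mx addrC.
  by rewrite subrK.
- by rewrite mulmxBr mulmx1 -!scalemxAr BV subrK.
- rewrite mulmxBr mulmx1 -!scalemxAr BW scalerBr scalemx1.
  by rewrite addrC addrA subrK.
Qed.

Lemma cayley_contractive {R : realType} {m n : nat} (a : R[i])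
    (A : 'M[R[i]]_m) (B : 'M[R[i]]_(m, n)) (C : 'M[R[i]]_(n, m))
    (D : 'M[R[i]]_n) E F G H :
  cayley_dominant a D C -> cayley_dominant a A B ->
  cayley_eqs a A B C D E F G H -> contractive E F G H.
Proof.
move=> domD domA [e1 e2 e3 e4] p x y b b0 hx hy.
apply: (cayley_contract a A B C D x _ _ y b domD domA) => //.
  rewrite !mulmxDr addrACA !mulmxA -mulmxDl e1; congr (_ + _).
  by rewrite -mulmxDl e2.
rewrite !mulmxDr addrACA !mulmxA -mulmxDl e3; congr (_ + _).
by rewrite -mulmxDl e4.
Qed.

Lemma contractive_sym {R : realType} {m n : nat} (E : 'M[R[i]]_n)
    (F : 'M[R[i]]_m) (G : 'M[R[i]]_(n, m)) (H : 'M[R[i]]_(m, n)) :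
  contractive E F G H -> contractive F E H G.
Proof.
move=> h p x y b b0 hx hy; have [h1 h2] := h p y x b b0 hy hx.
by rewrite addrC; split=> //; rewrite addrC.
Qed.

(** A fixed vector x of G H would be the output x' of the two-port with inputs
    x = 0 and y' = H x, and H x is itself an output for the input x; both
    passages shrink the norm strictly. *)
Lemma contractive_unit {R : realType} {m n : nat} (E : 'M[R[i]]_n)
    (F : 'M[R[i]]_m) (G : 'M[R[i]]_(n, m)) (H : 'M[R[i]]_(m, n)) :
  contractive E F G H -> 1%:M - G *m H \in unitmx.
Proof.
move=> h; apply: unitmx_ker0 => x; rewrite mulmxBl mul1mx => /subr0_eq hx.
apply: contrapT => /mxsup_gt0 x0.
have [_] := h _ x 0 _ x0 (lexx _) ltac:(by rewrite mxsup0 ltW).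
rewrite mulmx0 addr0 => /ltW h2.
have [+ _] := h _ 0 (H *m x) _ x0 ltac:(by rewrite mxsup0 ltW) h2.
by rewrite mulmx0 add0r mulmxA -hx ltxx.
Qed.

(** * The doubling step as a series connection *)

(** The signals x', y' on the line between the two copies of the two-port
    solve a loop equation with matrix 1 - G H. *)
Lemma sda_step_exists {F : fieldType} {m n p : nat} (s : sda_state F m n)
    (x : 'M[F]_(n, p)) (y : 'M[F]_(m, p)) :
  1%:M - sda_G s *m sda_H s \in unitmx ->
  exists x' y', x' = sda_E s *m x + sda_G s *m y' /\
                y' = sda_H s *m x' + sda_F s *m y.
Proof.
case: s => E K G H /= uGH.
have [x' x'E] : exists z, z = invmx (1%:M - G *m H) *m (E *m x + G *m K *m y).
  by exists (invmx (1%:M - G *m H) *m (E *m x + G *m K *m y)).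
exists x', (H *m x' + K *m y); split=> //.
have : (1%:M - G *m H) *m x' = E *m x + G *m K *m y.
  by rewrite x'E mulmxA mulmxV // mul1mx.
rewrite mulmxBl mul1mx => /eqP; rewrite subr_eq => /eqP {1}->.
by rewrite mulmxDr !mulmxA -addrA [G *m K *m y + _]addrC.
Qed.

(** The new two-port applied to the outer signals x and y returns what the two
    connected copies return: this is the meaning of the doubling formulas. *)
Lemma sda_step_compose {F : fieldType} {m n p : nat} (s : sda_state F m n)
    (x x' : 'M[F]_(n, p)) (y y' : 'M[F]_(m, p)) :
  1%:M - sda_G s *m sda_H s \in unitmx ->
  1%:M - sda_H s *m sda_G s \in unitmx ->
  x' = sda_E s *m x + sda_G s *m y' -> y' = sda_H s *m x' + sda_F s *m y ->
  let s' := sda_step s in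
  sda_E s' *m x + sda_G s' *m y = sda_E s *m x' + sda_G s *m y /\
  sda_H s' *m x + sda_F s' *m y = sda_H s *m x + sda_F s *m y'.
Proof.
case: s => E K G H /= uGH uHG ex ey.
have -> : x' = invmx (1%:M - G *m H) *m (E *m x + G *m K *m y).
  suff <- : (1%:M - G *m H) *m x' = E *m x + G *m K *m y.
    by rewrite mulmxA mulVmx // mul1mx.
  rewrite mulmxBl mul1mx {1}ex {1}ey mulmxDr !mulmxA.
  by rewrite [G *m H *m x' + _]addrC addrA addrK.
have -> : y' = invmx (1%:M - H *m G) *m (H *m E *m x + K *m y).
  suff <- : (1%:M - H *m G) *m y' = H *m E *m x + K *m y.
    by rewrite mulmxA mulVmx // mul1mx.
  rewrite mulmxBl mul1mx {1}ey {1}ex mulmxDr !mulmxA.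
  by rewrite addrAC addrK.
by split; rewrite mulmxDl !mulmxDr !mulmxA addrA // addrAC.
Qed.

(** If the inner signals were not bounded by b, the largest of them would be a
    strict contraction of itself; hence they are, and the outer signals are
    outputs for inputs bounded by b. *)
Lemma contractive_step {R : realType} {m n : nat} (s : sda_state R[i] m n) :
  contractive (sda_E s) (sda_F s) (sda_G s) (sda_H s) ->
  let s' := sda_step s in
  contractive (sda_E s') (sda_F s') (sda_G s') (sda_H s').
Proof.
move=> h s' p x y b b0 hx hy.
have uGH := contractive_unit _ _ _ _ h.
have uHG := contractive_unit _ _ _ _ (contractive_sym _ _ _ _ h).
have [x' [y' [ex ey]]] := sda_step_exists s x y uGH.
have [-> ->] := sda_step_compose s x x' y y' uGH uHG ex ey.
pose c := Num.max b (Num.max (mxsup x') (mxsup y')).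
have c0 : 0 < c by rewrite lt_max b0.
have bc : b <= c by rewrite le_max lexx.
have xc : mxsup x' <= c by rewrite !le_max lexx orbT.
have yc : mxsup y' <= c by rewrite !le_max lexx !orbT.
have [hc1 _] := h _ x y' c c0 (le_trans hx bc) yc; rewrite -ex in hc1.
have [_ hc2] := h _ x' y c c0 xc (le_trans hy bc); rewrite -ey in hc2.
have : Num.max (mxsup x') (mxsup y') < c by rewrite gt_max hc1 hc2.
rewrite /c lt_max ltxx orbF gt_max => /andP[/ltW hx' /ltW hy'].
have [h1 _] := h _ x' y b b0 hx' hy.
by have [_ h2] := h _ x y' b b0 hx hy'.
Qed.

(** The two-port of [s] is satisfied by x = 1, x' = T, y = X, y' = X T, that
    is, the trajectory generated by T stays on the graph of X. *)
Definition graph_invariant {F : fieldType} {m n : nat} (s : sda_state F m n)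
    (X : 'M[F]_(m, n)) (T : 'M[F]_n) : Prop :=
  T = sda_E s + sda_G s *m (X *m T) /\ X = sda_H s + sda_F s *m (X *m T).

(** Two consecutive steps of the trajectory 1, T, T^2 satisfy the connected
    two-port. *)
Lemma graph_invariant_step {F : fieldType} {m n : nat} (s : sda_state F m n)
    (X : 'M[F]_(m, n)) (T : 'M[F]_n) :
  1%:M - sda_G s *m sda_H s \in unitmx ->
  1%:M - sda_H s *m sda_G s \in unitmx ->
  graph_invariant s X T -> graph_invariant (sda_step s) X (T *m T).
Proof.
move=> uGH uHG [hT hX].
have hy : X *m T = sda_H s *m T + sda_F s *m (X *m (T *m T)).
  by rewrite {1}hX mulmxDl !mulmxA.
have [] := sda_step_compose s 1%:M T (X *m (T *m T)) (X *m T) uGH uHG _ hy.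
  by rewrite mulmx1.
rewrite !mulmx1 => e1 e2; split; last by rewrite e2.
by rewrite e1 {1}hT mulmxDl !mulmxA.
Qed.

(** * Geometric decay of powers *)

Lemma linear_recursion_decay {R : realType} (u : nat -> R) (a c rho : R) :
  0 <= a < 1 -> 0 <= c -> 0 < rho < 1 ->
  (forall N, u N.+1 <= a * u N + c * rho ^+ N) ->
  exists c' rho', [/\ 0 <= c', 0 < rho' < 1 & forall N, u N <= c' * rho' ^+ N].
Proof.
move=> /andP[a0 a1] c0 /andP[r0 r1] hu.
pose q := Num.max a rho; pose rho' := (q + 1) / 2.
have aq : a <= q by rewrite le_max lexx.
have rq : rho <= q by rewrite le_max lexx orbT.
have q1 : q < 1 by rewrite gt_max a1.
have ar : 0 < rho' - a by rewrite /rho'; lra.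
(* With the rate rho' > max a rho, the constant c' is preserved by the
   recursion as soon as a c' + c <= rho' c'. *)
exists (Num.max `|u 0%N| (c / (rho' - a))), rho'.
set c' := Num.max _ _.
have c'0 : 0 <= c' by rewrite le_max normr_ge0.
have hr' : 0 < rho' < 1 by rewrite /rho'; lra.
have hcc : c <= c' * (rho' - a).
  by rewrite -ler_pdivrMr // le_max lexx orbT.
split=> //; elim=> [|N IH].
  by rewrite expr0 mulr1 le_max ler_norm.
apply: (le_trans (hu N)).
have p1 : rho ^+ N <= rho' ^+ N.
  by apply: lerXn2r; rewrite ?nnegrE; rewrite /rho'; lra.
have : c * rho ^+ N <= c' * (rho' - a) * rho' ^+ N.
  by apply: ler_pM => //; rewrite exprn_ge0 // ltW.
have : a * u N <= a * (c' * rho' ^+ N) by rewrite ler_wpM2l.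
rewrite exprS; lra.
Qed.

(** Induction on the linear factors: if T^N (T - z) M decays geometrically,
    then T^N M satisfies the recursion u_(N+1) = z u_N + (decaying term), and
    |z| < 1. *)
Lemma power_decay_prod {R : realType} {n : nat} (T : 'M[R[i]]_n.+1)
    (r : seq R[i]) (M : 'M[R[i]]_n.+1) :
  (forall z, z \in r -> normc z < 1) ->
  horner_mx T (\prod_(z <- r) ('X - z%:P)) * M = 0 ->
  exists c rho, [/\ 0 <= c, 0 < rho < 1 &
    forall N, mxsup (T ^+ N * M) <= c * rho ^+ N].
Proof.
elim: r M => [|z r IH] M hr.
  rewrite big_nil rmorph1 mul1r => ->; exists 0, 2^-1; split=> //; first by lra.
  by move=> N; rewrite mulr0 mxsup0 mul0r.
rewrite big_cons mulrC rmorphM /= rmorphB /= horner_mx_X horner_mx_C -mulrA.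
move=> h; have [|c [rho [c0 hrho hN]]] := IH _ _ h.
  by move=> w wr; apply: hr; rewrite inE wr orbT.
have z1 : 0 <= normc z < 1 by rewrite normc_ge0 hr // inE eqxx.
apply: (linear_recursion_decay _ (normc z) c rho) => // N.
rewrite (_ : T ^+ N.+1 * M = z *: (T ^+ N * M) + T ^+ N * ((T - z%:M) * M)).
  exact: le_trans (mxsupD _ _) (lerD (mxsupZ _ _) (hN N)).
have zM : z%:M * M = z *: M by exact: mul_scalar_mx.
by rewrite mulrBl mulrBr mulrA -exprSr zM -scalerAr addrC subrK.
Qed.

Lemma power_decay {R : realType} {n : nat} (T : 'M[R[i]]_n.+1) :
  (forall z, eigenvalue T z -> normc z < 1) ->
  exists c rho, [/\ 0 <= c, 0 < rho < 1 &
    forall N, mxsup (T ^+ N) <= c * rho ^+ N].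
Proof.
move=> hT; have [r hr] := closed_field_poly_normal (char_poly T).
rewrite (monicP (char_poly_monic T)) scale1r in hr.
have [||c [rho [c0 hrho h]]] := power_decay_prod T r 1.
- by move=> z zr; apply: hT; rewrite eigenvalue_root_char hr root_prod_XsubC.
- by rewrite -hr Cayley_Hamilton mul0r.
by exists c, rho; split=> // N; rewrite -[T ^+ N]mulr1.
Qed.

(** * Location of the spectrum *)

(** Eigenvalues are defined by row vectors; Gershgorin's estimate of row sums
    needs a column vector. *)
Lemma eigenvalue_col {F : fieldType} {n : nat} (M : 'M[F]_n) (z : F) :
  eigenvalue M z -> exists2 x : 'cV[F]_n, x <> 0 & M *m x = z *: x.
Proof.
move=> /eigenvalueP [v hv v0]; apply: contrapT => h; case/eqP: v0.
have u : M - z%:M \in unitmx.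
  apply: unitmx_ker0 => x; rewrite mulmxBl mul_scalar_mx => /subr0_eq hx.
  by apply: contrapT => x0; apply: h; exists x.
have : v *m (M - z%:M) = 0 by rewrite mulmxBr mul_mx_scalar hv subrr.
by move=> /(congr1 (mulmx^~ (invmx (M - z%:M)))); rewrite mulmxK // mul0mx.
Qed.

Lemma gershgorin_row {R : realType} {m n p : nat} (D : 'M[R[i]]_n)
    (C : 'M[R[i]]_(n, m)) (x : 'M[R[i]]_(n, p)) (y : 'M[R[i]]_(m, p)) z :
  D *m x + C *m y = z *: x -> 0 < mxsup x -> mxsup y <= mxsup x ->
  exists i, normc (D i i - z) <= rowsum D C i.
Proof.
move=> hz x0 hy; have [i [j hc]] := mxsup_attained x x0; exists i.
have := row_estimate D C x y _ i j (lexx _) hy.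
rewrite hz mxE -mulrBl normcM -[normc (z - _)]normcN opprB -hc.
by rewrite ler_pM2r.
Qed.

Lemma riccati_solE {R : realType} {m n : nat} (A : 'M[R[i]]_m)
    (B : 'M[R[i]]_(m, n)) (C : 'M[R[i]]_(n, m)) (D : 'M[R[i]]_n)
    (X : 'M[R[i]]_(m, n)) :
  riccati_sol A B C D X -> B = A *m X + X *m (D - C *m X).
Proof.
move/eqP; rewrite addr_eq0 -eqr_oppLR => /eqP <-.
by rewrite !opprB mulmxBr mulmxA.
Qed.

(** If (D - C X) x = z x, then (x, X x) is an eigenvector of the matrix
    [block_mx D C (- B) (- A)], so z lies in a Gershgorin disc of a row of D or
    of - A.  The latter discs lie in Rew < 0, and the former stay in Rew > 0
    after multiplication by chi, because |Rew| <= |.|. *)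
Lemma riccati_spectrum_rotate {R : realType} {m n : nat} (omega : R)
    (chi : R[i]) (A : 'M[R[i]]_m) (B : 'M[R[i]]_(m, n)) (C : 'M[R[i]]_(n, m))
    (D : 'M[R[i]]_n) (X : 'M[R[i]]_(m, n)) z :
  0 <= omega <= 1 -> normc chi = 1 ->
  (forall i, rowsum D C i < Rew omega (chi * D i i)) ->
  (forall i, rowsum A B i < Rew omega (A i i)) ->
  riccati_sol A B C D X ->
  eigenvalue (D - C *m X) z -> 0 < Rew omega z -> 0 < Rew omega (chi * z).
Proof.
move=> ho chi1 domD domA hX /eigenvalue_col [x x0 hx] hz.
have x0' := mxsup_gt0 _ x0.
have eD : D *m x + C *m (- (X *m x)) = z *: x.
  by rewrite -hx mulmxBl mulmxN mulmxA.
have eA : A *m (- (X *m x)) + B *m x = (- z) *: (- (X *m x)).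
  rewrite scaleNr scalerN opprK scalemxAr -hx [B](riccati_solE _ _ _ _ _ hX).
  by rewrite mulmxDl mulmxN -!mulmxA addKr.
have [le_yx | /ltW le_xy] := leP (mxsup (- (X *m x))) (mxsup x).
  have [i hi] := gershgorin_row D C x _ z eD x0' le_yx.
  have := Rew_le_normc omega (chi * (D i i - z)) ho.
  rewrite normcM chi1 mul1r mulrBr RewD RewN; have := domD i; lra.
have [i hi] := gershgorin_row A B _ x (- z) eA (lt_le_trans x0' le_xy) le_xy.
have := Rew_le_normc omega (A i i - - z) ho.
rewrite RewD !RewN; have := domA i; clear eD eA; lra.
Qed.

Definition cayley {F : fieldType} {n : nat} (a : F) (S : 'M[F]_n) : 'M[F]_n :=
  (S - a%:M) *m invmx (S + a%:M).

Lemma cayleyE {F : fieldType} {n : nat} (a : F) (S : 'M[F]_n) :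
  S + a%:M \in unitmx -> (S + a%:M) *m cayley a S = S - a%:M.
Proof.
move=> u; rewrite /cayley mulmxA.
have -> : (S + a%:M) *m (S - a%:M) = (S - a%:M) *m (S + a%:M).
  rewrite !(mulmxDl, mulmxDr) !mulmxN !mulNmx !mul_scalar_mx !mul_mx_scalar.
  by rewrite -!addrA; congr (_ + _); rewrite [RHS]addrCA.
by rewrite mulmxK.
Qed.

Lemma shift_spectrum_unit {R : realType} {n : nat} (omega t : R)
    (S : 'M[R[i]]_n) :
  0 < t -> (forall z, eigenvalue S z -> 0 < Rew omega z) ->
  S + (t%:C * zperp omega)%:M \in unitmx.
Proof.
move=> t0 hS; rewrite unitmxE unitfE; apply/negP => /det0P [v v0].
rewrite mulmxDr mul_mx_scalar => /eqP; rewrite addr_eq0 -scaleNr => /eqP hv.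
have := hS _ (introT eigenvalueP (ex_intro2 _ _ v hv v0)).
by rewrite RewN Rew_zperp oppr_gt0 ltNge mulr_ge0 // ltW // varpi_gt0.
Qed.

(** An eigenvalue mu of the Cayley transform comes from the eigenvalue
    z = a (1 + mu) / (1 - mu) of S, for which z - a = mu (z + a); and z is
    closer to a than to - a since Rew z > 0. *)
Lemma cayley_spectrum {R : realType} {n : nat} (omega t : R)
    (S : 'M[R[i]]_n) :
  0 < t -> (forall z, eigenvalue S z -> 0 < Rew omega z) ->
  forall mu, eigenvalue (cayley (t%:C * zperp omega) S) mu -> normc mu < 1.
Proof.
move=> t0 hS mu /eigenvalueP [v hv v0].
have u := shift_spectrum_unit omega t S t0 hS.
move: u hv; set a := t%:C * zperp omega => u hv.
have {}hv : v *m (S - a%:M) = mu *: (v *m (S + a%:M)).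
  by rewrite scalemxAl -hv /cayley mulmxA mulmxKV.
have w0 := varpi_gt0 omega.
have a0 : a != 0.
  apply/eqP => a0; have := Rew_zperp omega t; rewrite -/a a0 /Rew /= !mulr0.
  rewrite addr0 => /esym/eqP; rewrite mulf_eq0 !gt_eqF //.
have hv' : (1 - mu) *: (v *m S) = (a * (1 + mu)) *: v.
  move: hv; rewrite mulmxBr mulmxDr !mul_mx_scalar scalerDr scalerA.
  move=> h; rewrite scalerBl scale1r mulrDr mulr1 scalerDl.
  move/eqP: h; rewrite subr_eq => /eqP h; apply/eqP; rewrite subr_eq.
  by rewrite {1}h [a * mu]mulrC addrC -addrA [_ *: v + mu *: _]addrC.
have mu1 : 1 - mu != 0.
  apply/eqP => mu1; move: hv'; rewrite mu1 scale0r => /esym/eqP.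
  rewrite scalemx_eq0 (negbTE v0) orbF mulf_eq0 (negbTE a0) /=.
  by rewrite -(subr0_eq mu1) -(natrD _ 1 1) pnatr_eq0.
have hS' := hS (a * (1 + mu) / (1 - mu)).
set z := a * _ / _ in hS'.
have {hS'} hz : 0 < Rew omega z.
  apply: hS'; apply/eigenvalueP; exists v => //.
  by rewrite /z mulrC -scalerA -hv' scalerA mulVf // scale1r.
have ez : z - a = mu * (z + a).
  by rewrite /z; field.
have [hm hp] := normc_subD_sqr omega t z.
rewrite -/a ez normcM in hm hp.
have := normc_ge0 (z + a); have := normc_ge0 mu.
move: hm hp; move: (normc mu) (normc (z + a)) (normc z) => M P Z hm hp M0 P0.
have tz : 0 < t * Rew omega z by rewrite mulr_gt0.
have PP : (M * P) ^+ 2 < P ^+ 2.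
  by rewrite -subr_gt0 hm hp; clear -tz; lra.
rewrite ltNge; apply/negP => M1; move: PP; rewrite ltNge => /negP; apply.
by rewrite ler_sqr ?nnegrE ?mulr_ge0 // ler_peMl.
Qed.

(** * The invariant graph and convergence *)

(** By [riccati_solE] and (S + a) T = S - a, the vectors (T, X) and (1, X T)
    satisfy (Q' + a) (T, X) = (Q' - a) (1, X T).  The two-port applied to
    (1, X T) solves the same equation, and Q' + a is injective. *)
Lemma graph_invariant_init {R : realType} {m n : nat} (a : R[i])
    (A : 'M[R[i]]_m) (B : 'M[R[i]]_(m, n)) (C : 'M[R[i]]_(n, m))
    (D : 'M[R[i]]_n) (s : sda_state R[i] m n) (X : 'M[R[i]]_(m, n)) :
  cayley_dominant a D C -> cayley_dominant a A B ->
  cayley_eqs a A B C D (sda_E s) (sda_F s) (sda_G s) (sda_H s) ->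
  riccati_sol A B C D X -> D - C *m X + a%:M \in unitmx ->
  graph_invariant s X (cayley a (D - C *m X)).
Proof.
case: s => E F G H /= domD domA [e1 e2 e3 e4] hX /cayleyE.
set S := D - _; set T := cayley a S => hT.
have hBS : B = A *m X + X *m S := riccati_solE _ _ _ _ _ hX.
suff [] : T - (E + G *m (X *m T)) = 0 /\ X - (H + F *m (X *m T)) = 0.
  by move=> /subr0_eq ? /subr0_eq.
have hD (e : 'M[R[i]]_n) : D + e = S + e + C *m X by rewrite addrAC /S subrK.
clearbody T S.
have u1 Z : (D + a%:M) *m (E + G *m Z) + C *m (H + F *m Z) =
    D - a%:M + C *m Z.
  by rewrite !mulmxDr addrACA !mulmxA e1 -mulmxDl e2.
have u2 Z : B *m (E + G *m Z) + (A + a%:M) *m (H + F *m Z) =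
    B + (A - a%:M) *m Z.
  by rewrite !mulmxDr addrACA !mulmxA e3 -!mulmxDl e4.
apply: (cayley_ker0 a A B C D) => //.
  rewrite !mulmxBr addrACA -opprD u1; apply/eqP; rewrite subr_eq0; apply/eqP.
  by rewrite !hD mulmxDl hT -!mulmxA addrAC.
rewrite !mulmxBr addrACA -opprD u2; apply/eqP; rewrite subr_eq0; apply/eqP.
rewrite hBS mulmxDl -[X *m S *m T]mulmxA.
have -> : S *m T = S - a%:M - a *: T.
  by rewrite -hT mulmxDl mul_scalar_mx addrK.
rewrite !(mulmxDl, mulmxBr, mulNmx) !mul_scalar_mx mul_mx_scalar -scalemxAr.
rewrite -!mulmxA.
move: (A *m (X *m T)) (X *m S) (a *: X) (a *: (X *m T)) (A *m X).
move=> M1 M2 M3 M4 M5.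
by apply/matrixP => i j; rewrite !mxE; ring.
Qed.

(** The state of the algorithm for the dual equation. *)
Definition sda_swap {F : fieldType} {m n : nat} (s : sda_state F m n) :
    sda_state F n m :=
  SdaState (sda_F s) (sda_E s) (sda_H s) (sda_G s).

Lemma iter_sda_swap {F : fieldType} {m n : nat} (s : sda_state F m n) k :
  iter k (@sda_step _ _ _) (sda_swap s) = sda_swap (iter k (@sda_step _ _ _) s).
Proof.
by elim: k => // k IH; rewrite !iterS IH; case: (iter _ _ _).
Qed.

Lemma contractive_iter {R : realType} {m n : nat} (s : sda_state R[i] m n) k :
  contractive (sda_E s) (sda_F s) (sda_G s) (sda_H s) ->
  let s' := iter k (@sda_step _ _ _) s in
  contractive (sda_E s') (sda_F s') (sda_G s') (sda_H s').
Proof.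
by move=> h; elim: k => // k IH; rewrite iterS; exact: contractive_step IH.
Qed.

(** X - H_k = F_k X T^(2^k), where F_k is part of a contraction and T^(2^k)
    decays. *)
Lemma sda_doubling_decay {R : realType} {m n : nat}
    (s : sda_state R[i] m n.+1) (X : 'M[R[i]]_(m, n.+1)) (T : 'M[R[i]]_n.+1) :
  contractive (sda_E s) (sda_F s) (sda_G s) (sda_H s) ->
  graph_invariant s X T -> (forall z, eigenvalue T z -> normc z < 1) ->
  exists K rho, [/\ 0 <= K, 0 < rho < 1 & forall k,
    mxsup (sda_H (iter k (@sda_step _ _ _) s) - X) <= K * rho ^+ (2 ^ k)].
Proof.
move=> hs hX /power_decay [c [rho [c0 hrho hT]]].
have inv k : graph_invariant (iter k (@sda_step _ _ _) s) X (T ^+ (2 ^ k)).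
  elim: k => [|k IH]; first by rewrite expn0 expr1.
  have hk := contractive_iter s k hs.
  rewrite iterS expnS mul2n -addnn exprD; apply: graph_invariant_step IH.
    exact: contractive_unit hk.
  exact: contractive_unit (contractive_sym _ _ _ _ hk).
have /andP[r0 r1] := hrho.
have K0 : 0 <= n.+1%:R * mxsup X * c by rewrite !mulr_ge0 ?mxsup_ge0.
(* The summand 1 keeps the bound positive when X = 0, as contractivity
   requires. *)
exists (n.+1%:R * mxsup X * c + 1), rho; split=> //; first by rewrite addr_ge0.
move=> k; have [_ hk] := inv k.
have b0 : 0 < (n.+1%:R * mxsup X * c + 1) * rho ^+ (2 ^ k).
  by rewrite mulr_gt0 ?exprn_gt0 // ltr_wpDl.
set b := _ * _ in b0 *.
have hb : mxsup (X *m T ^+ (2 ^ k)) <= b.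
  apply: (le_trans (mxsupM _ _)).
  apply: (@le_trans _ _ (n.+1%:R * mxsup X * (c * rho ^+ (2 ^ k)))).
    by rewrite ler_wpM2l // mulr_ge0 ?mxsup_ge0.
  by rewrite /b mulrDl mul1r mulrA lerDl exprn_ge0 // ltW.
have [] := contractive_iter s k hs _ 0 _ _ b0 _ hb; first by rewrite mxsup0 ltW.
move=> _; rewrite mulmx0 add0r => /ltW hF.
rewrite {1}hk opprD addrA subrr add0r -scaleN1r (le_trans (mxsupZ _ _)) //.
by rewrite normcN normc1 mul1r.
Qed.

Lemma matrix_norm_le_mxsup {R : realType} {m n : nat}
    (N : 'M[R[i]]_(m, n) -> R) :
  matrix_norm N -> exists2 K, 0 <= K & forall M, N M <= K * mxsup M.
Proof.
move=> [N0 _ NZ ND]; exists (\sum_i \sum_j N (delta_mx i j)).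
  by apply: sumr_ge0 => i _; apply: sumr_ge0.
have Nsum (I : finType) (f : I -> 'M[R[i]]_(m, n)) :
    N (\sum_i f i) <= \sum_i N (f i).
  elim/big_ind2: _ => [|x1 x2 y1 y2 h1 h2|//].
    by rewrite -(scale0r 0) NZ normc0 mul0r.
  exact: le_trans (ND _ _) (lerD h1 h2).
move=> M; rewrite {1}[M]matrix_sum_delta mulr_suml.
apply: (le_trans (Nsum _ _)); apply: ler_sum => i _; rewrite mulr_suml.
apply: (le_trans (Nsum _ _)); apply: ler_sum => j _.
by rewrite NZ mulrC ler_wpM2l // le_mxsup.
Qed.

(** Every rate q > rho absorbs the constant: K rho^M <= q^M for large M = 2^k,
    and the M-th root of the right-hand side is q. *)
Lemma quadratic_cvg_of_mxsup {R : realType} {m n : nat}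
    (X : nat -> 'M[R[i]]_(m, n)) (L : 'M[R[i]]_(m, n)) (K rho : R) :
  0 <= K -> 0 < rho < 1 ->
  (forall k, mxsup (X k - L) <= K * rho ^+ (2 ^ k)) -> quadratic_cvg X L.
Proof.
move=> K0 /andP[r0 r1] hX N hN; have N0 := let: And4 h _ _ _ := hN in h.
have [K' K'0 hK'] := matrix_norm_le_mxsup N hN.
pose q := (rho + 1) / 2.
have q0 : 0 < q by rewrite /q; lra.
have q1 : q < 1 by rewrite /q; lra.
have rq : `|rho / q| < 1.
  rewrite ger0_norm; last by rewrite divr_ge0 // ltW.
  by rewrite ltr_pdivrMr // mul1r /q; lra.
have [k0 _ hk0] := cvgr_lt _ (cvg_geometric (K' * K) rq) _ ltr01.
have hk k : (k0 <= k)%N -> N (X k - L) `^ (1 / 2 ^+ k) <= q.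
  move=> k0k; have kM : (k0 <= 2 ^ k)%N.
    by rewrite (leq_trans k0k) // ltnW // ltn_expl.
  have := hk0 _ kM; rewrite /= expr_div_n mulrA.
  rewrite ltr_pdivrMr ?exprn_gt0 // => /ltW hq; rewrite mul1r in hq.
  have hN' : N (X k - L) <= q ^+ (2 ^ k).
    apply: (le_trans (hK' _)); apply: le_trans hq.
    by rewrite -mulrA ler_wpM2l.
  have e0 : 0 <= 1 / 2 ^+ k :> R by rewrite divr_ge0 // exprn_ge0.
  have qM : 0 <= q ^+ (2 ^ k) by rewrite exprn_ge0 // ltW.
  apply: (le_trans (ge0_ler_powR e0 (N0 _) qM hN')).
  rewrite -powR_mulrn ?(ltW q0) // -powRrM natrX mulrA mulr1 divff ?expf_neq0 //.
  by rewrite powRr1 ?(ltW q0).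
apply: (@le_lt_trans _ _ q%:E); last by rewrite lte_fin.
apply: ge_ereal_inf.
eexists; first by exists [set k | (k0 <= k)%N]%classic => //; exists k0.
apply: ge_ereal_sup => _ [k /= k0k <-].
by rewrite lee_fin hk.
Qed.

(** * Application to the matrix Q *)

Lemma rowsum_scale {R : realType} {m n : nat} (chi : R[i]) (D : 'M[R[i]]_n)
    (C : 'M[R[i]]_(n, m)) i :
  normc chi = 1 -> rowsum (chi *: D) (chi *: C) i = rowsum D C i.
Proof.
by move=> chi1; congr (_ + _); apply: eq_bigr => j _;
  rewrite mxE normcM chi1 mul1r.
Qed.

Lemma offdiag_sum_lshift {R : realType} {m n : nat} (A : 'M[R[i]]_m)
    (B : 'M[R[i]]_(m, n)) (C : 'M[R[i]]_(n, m)) (D : 'M[R[i]]_n) i :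
  offdiag_sum (riccati_Q A B C D) (lshift m i) = rowsum D C i.
Proof.
rewrite /offdiag_sum /rowsum /riccati_Q big_split_ord /=; congr (_ + _).
  by apply: eq_big => j; rewrite ?block_mxEul // eq_lshift.
by apply: eq_big => j; rewrite ?eq_rlshift // block_mxEur mxE normcN.
Qed.

Lemma offdiag_sum_rshift {R : realType} {m n : nat} (A : 'M[R[i]]_m)
    (B : 'M[R[i]]_(m, n)) (C : 'M[R[i]]_(n, m)) (D : 'M[R[i]]_n) i :
  offdiag_sum (riccati_Q A B C D) (rshift n i) = rowsum A B i.
Proof.
rewrite /offdiag_sum /rowsum /riccati_Q big_split_ord /= addrC; congr (_ + _).
  by apply: eq_big => j; rewrite ?block_mxEdr // eq_rshift.
by apply: eq_big => j; rewrite ?eq_lrshift // block_mxEdl mxE normcN.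
Qed.

Lemma comparison_mx_row_sum {R : realType} {k : nat} (omega : R)
    (Q : 'M[R[i]]_k) i :
  (comparison_mx omega Q *m const_mx 1) i (0 : 'I_1) =
    Rew omega (Q i i) - offdiag_sum Q i.
Proof.
rewrite mxE (bigD1 i) //= !mxE eqxx mulr1 -sumrN; congr (_ + _).
by apply: eq_bigr => j ji; rewrite !mxE eq_sym (negbTE ji) mulr1.
Qed.

Lemma p_ratio_dominance {R : realType} {k : nat} (omega t : R) (chi : R[i])
    (Q : 'M[R[i]]_k) i :
  0 <= omega <= 1 -> normc chi = 1 ->
  0 < Rew omega (chi * Q i i) - offdiag_sum Q i ->
  p_ratio omega chi Q i <= t ->
  let a := t%:C * zperp omega in
  0 < t /\ normc (chi * Q i i - a) + offdiag_sum Q i <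
           normc (chi * Q i i + a) - offdiag_sum Q i.
Proof.
move=> ho chi1 hq hp; apply: shift_dominance => //.
  by apply: sumr_ge0 => j _; exact: normc_ge0.
by rewrite normcM chi1 mul1r.
Qed.

(** The extremal solution is characterised by the spectrum of D - C X, whereas
    the algorithm sees chi (D - C X); [riccati_spectrum_rotate] relates the
    two.  The state [s] is arbitrary up to the Cayley equations, so that the
    lemma serves both the equation and its dual. *)
Lemma sda_quadratic_cvg {R : realType} {m n : nat} (omega t : R)
    (chi : R[i]) (A : 'M[R[i]]_m) (B : 'M[R[i]]_(m, n.+1))
    (C : 'M[R[i]]_(n.+1, m)) (D : 'M[R[i]]_n.+1) (X : 'M[R[i]]_(m, n.+1))
    (s : sda_state R[i] m n.+1) :
  let a := t%:C * zperp omega in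
  0 <= omega <= 1 -> normc chi = 1 -> 0 < t ->
  (forall i, rowsum D C i < Rew omega (chi * D i i)) ->
  (forall i, rowsum A B i < Rew omega (A i i)) ->
  cayley_dominant a (chi *: D) (chi *: C) ->
  cayley_dominant a (chi *: A) (chi *: B) ->
  cayley_eqs a (chi *: A) (chi *: B) (chi *: C) (chi *: D)
    (sda_E s) (sda_F s) (sda_G s) (sda_H s) ->
  extremal_sol omega A B C D X ->
  quadratic_cvg (fun k => sda_H (iter k (@sda_step _ _ _) s)) X.
Proof.
move=> a ho chi1 t0 hD hA domD domA hs [hX spX].
have chi0 : chi != 0.
  apply/eqP => chi0; move/eqP: chi1.
  by rewrite chi0 normc0 eq_sym oner_eq0.
have eS : chi *: D - chi *: C *m X = chi *: (D - C *m X).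
  by rewrite scalerBr -scalemxAl.
have hX' : riccati_sol (chi *: A) (chi *: B) (chi *: C) (chi *: D) X.
  rewrite /riccati_sol -!scalemxAr -!scalemxAl -!scalerBr -scalerDr.
  by rewrite hX scaler0.
have spS z : eigenvalue (chi *: D - chi *: C *m X) z -> 0 < Rew omega z.
  move=> /eigenvalueP [v hv v0].
  have ez : z = chi * (chi^-1 * z) by rewrite mulrA mulfV // mul1r.
  have hz : eigenvalue (D - C *m X) (chi^-1 * z).
    apply/eigenvalueP; exists v => //.
    by rewrite -scalerA -hv eS -scalemxAr scalerA mulVf // scale1r.
  rewrite ez.
  exact: (riccati_spectrum_rotate omega chi A B C D X _ ho chi1 hD hA hX hz
           (spX _ hz)).
have inv := graph_invariant_init a _ _ _ _ s X domD domA hs hX'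
  (shift_spectrum_unit omega t _ t0 spS).
have hc := cayley_contractive a _ _ _ _ _ _ _ _ domD domA hs.
have [K [rho [K0 hrho hk]]] :=
  sda_doubling_decay s X _ hc inv (cayley_spectrum omega t _ t0 spS).
exact: quadratic_cvg_of_mxsup hk.
Qed.

Theorem theorem6p8 (R : realType) (m n : nat) (omega : R)
    (A : 'M[R[i]]_(m.+1)) (B : 'M[R[i]]_(m.+1, n.+1))
    (C : 'M[R[i]]_(n.+1, m.+1)) (D : 'M[R[i]]_(n.+1))
    (Phi : 'M[R[i]]_(m.+1, n.+1)) (Psi : 'M[R[i]]_(n.+1, m.+1))
    (chi : R[i]) (t : R) :
  let Q := riccati_Q A B C D in
  let psi1 := max_ord (fun i : 'I_m.+1 => p_ratio omega chi Q (rshift n.+1 i)) in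
  let psi2 := max_ord (fun i : 'I_n.+1 => p_ratio omega chi Q (lshift m.+1 i)) in
  let alpha := t%:C * zperp omega in
  let s := sda alpha (chi *: A) (chi *: B) (chi *: C) (chi *: D) in
  0 <= omega <= 1 ->
  class_H omega A B C D ->
  pos_cV (comparison_mx omega Q *m const_mx 1) ->
  extremal_sol omega A B C D Phi ->
  extremal_sol omega D C B A Psi ->
  normc chi = 1 ->
  (forall i, 0 < Rew omega (chi * Q i i) - offdiag_sum Q i) ->
  Num.max psi1 psi2 <= t ->
  [/\ sda_well_defined alpha (chi *: A) (chi *: B) (chi *: C) (chi *: D),
      quadratic_cvg (fun k => sda_H (s k)) Phi
    & quadratic_cvg (fun k => sda_G (s k)) Psi].
Proof.
move=> Q psi1 psi2 a s ho _ hQ hPhi hPsi chi1 hchi.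
rewrite ge_max => /andP[ht1 ht2].
have QD i : Q (lshift m.+1 i) (lshift m.+1 i) = D i i by exact: block_mxEul.
have QA i : Q (rshift n.+1 i) (rshift n.+1 i) = A i i by exact: block_mxEdr.
have qD i : offdiag_sum Q (lshift m.+1 i) = rowsum D C i.
  exact: offdiag_sum_lshift.
have qA i : offdiag_sum Q (rshift n.+1 i) = rowsum A B i.
  exact: offdiag_sum_rshift.
have hD i : rowsum D C i < Rew omega (D i i).
  by have := hQ (lshift _ i); rewrite comparison_mx_row_sum QD qD subr_gt0.
have hA i : rowsum A B i < Rew omega (A i i).
  by have := hQ (rshift _ i); rewrite comparison_mx_row_sum QA qA subr_gt0.
have hDchi i : rowsum D C i < Rew omega (chi * D i i).
  by have := hchi (lshift _ i); rewrite QD qD subr_gt0.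
have hAchi i : rowsum A B i < Rew omega (chi * A i i).
  by have := hchi (rshift _ i); rewrite QA qA subr_gt0.
have domD' i : 0 < t /\ normc (chi * D i i - a) + rowsum D C i <
                        normc (chi * D i i + a) - rowsum D C i.
  rewrite -QD -qD; apply: p_ratio_dominance => //.
  apply: le_trans ht2.
  exact: (le_bigmax _ (fun i => p_ratio _ _ _ (lshift _ i))).
have domA' i : normc (chi * A i i - a) + rowsum A B i <
               normc (chi * A i i + a) - rowsum A B i.
  rewrite -QA -qA; apply: (p_ratio_dominance _ _ _ _ _ ho chi1 _ _).2 => //.
  apply: le_trans ht1.
  exact: (le_bigmax _ (fun i => p_ratio _ _ _ (rshift _ i))).
have t0 : 0 < t := (domD' ord0).1.
have domD : cayley_dominant a (chi *: D) (chi *: C).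
  by move=> i; rewrite mxE rowsum_scale //; case: (domD' i).
have domA : cayley_dominant a (chi *: A) (chi *: B).
  by move=> i; rewrite mxE rowsum_scale //; exact: domA'.
have uA : sda_A a (chi *: A) \in unitmx := shift_unit _ _ _ domA.
have uD : sda_D a (chi *: D) \in unitmx := shift_unit _ _ _ domD.
have uW := schur_unit a _ _ _ _ domD domA.
have uV : sda_V a (chi *: A) (chi *: B) (chi *: C) (chi *: D) \in unitmx :=
  schur_unit a _ _ _ _ domA domD.
have hs := sda_init_cayley a _ _ _ _ uA uD uW uV.
have hc := cayley_contractive a _ _ _ _ _ _ _ _ domD domA hs.
split.
- apply: And5 uA uD uW uV _ => k; have hk := contractive_iter _ k hc.
  split; first exact: contractive_unit hk.
  exact: contractive_unit (contractive_sym _ _ _ _ hk).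
- exact: (sda_quadratic_cvg omega t chi A B C D Phi _ ho chi1 t0 hDchi hA
           domD domA hs hPhi).
- have hs' : cayley_eqs a (chi *: D) (chi *: C) (chi *: B) (chi *: A)
      (sda_F (s 0%N)) (sda_E (s 0%N)) (sda_H (s 0%N)) (sda_G (s 0%N)).
    by case: hs => e1 e2 e3 e4; split; rewrite addrC.
  have := sda_quadratic_cvg omega t chi D C B A Psi (sda_swap (s 0%N)) ho chi1
    t0 hAchi hD domA domD hs' hPsi.
  by under eq_fun do rewrite iter_sda_swap.
Qed.
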